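(* Let $d,n,M\in\mathbb{N}$ with $n\ge M$, let $t_1,\dots,t_M\in[0,1)^d$ be pairwise distinct, let $z_j:=\mathrm{e}^{2\pi\mathrm{i}t_j}\in\mathbb{T}^d$ and $\Omega:=\{z_j:j=1,\dots,M\}$, let $\hat f_1,\dots,\hat f_M\in\mathbb{C}\setminus\{0\}$, and let $T_n=T_n(f)$ be the multilevel Toeplitz matrix of $f(k)=\sum_{j=1}^M\hat f_jz_j^k$, $k\in\mathbb{Z}^d$. Let $N=(n+1)^d$ and let $\hat p_1,\dots,\hat p_N$ be an orthonormal basis of $\mathbb{C}^N$ such that $\hat p_\ell\in(\ker T_n)^\perp$ for $\ell=1,\dots,M$. Put $p_\ell\colon(\mathbb{C}\setminus\{0\})^d\to\mathbb{C}$, $p_\ell(z)=\sum_{k\in I_n}\hat p_{\ell,k}z^k$. Then the function $p\colon[0,1)^d\to\mathbb{C}$, $$p(t)=\frac1N\sum_{\ell=1}^M\left|p_\ell(\mathrm{e}^{2\pi\mathrm{i}t})\right|^2,$$ is a trigonometric polynomial of degree $n$ and fulfills $0\le p(t)\le1$ for all $t\in[0,1)^d$, and $p(t)=1$ if and only if $t=t_j$ for some $j\in\{1,\dots,M\}$.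
   Context: For $t\in\mathbb{R}^d$ write $\mathrm{e}^{2\pi\mathrm{i}t}:=(\mathrm{e}^{2\pi\mathrm{i}t_1},\dots,\mathrm{e}^{2\pi\mathrm{i}t_d})\in\mathbb{T}^d$ (here $t_1,\dots,t_d$ are the coordinates of $t$), where $\mathbb{T}=\{z\in\mathbb{C}:|z|=1\}$. For $z\in(\mathbb{C}\setminus\{0\})^d$ and $k\in\mathbb{Z}^d$ write $z^k:=z_1^{k_1}\cdots z_d^{k_d}$. Let $I_n:=\{0,\dots,n\}^d$ and $N:=|I_n|=(n+1)^d$; vectors in $\mathbb{C}^N$ are indexed by $I_n$, and $\mathbb{C}^N$ carries the standard Hermitian inner product, with respect to which orthonormality and the orthogonal complement $\perp$ are taken. For $f\colon\mathbb{Z}^d\to\mathbb{C}$, the matrix $T_n(f)\in\mathbb{C}^{N\times N}$ has entry $f(k-\ell)$ in row $\ell\in I_n$ and column $k\in I_n$; that is, $(T_n(f)\hat p)_\ell=\sum_{k\in I_n}f(k-\ell)\hat p_k$. A trigonometric polynomial is a finite complex linear combination of the functions $t\mapsto\mathrm{e}^{2\pi\mathrm{i}(k_1t_1+\dots+k_dt_d)}$, $k\in\mathbb{Z}^d$; its degree refers to the max-norm $\|k\|_\infty$ of the frequencies $k$. *)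

(* Defs.v *)
From mathcomp Require Import all_boot all_order all_algebra.
From mathcomp Require Import sesquilinear spectral.
From mathcomp Require Import all_classical all_reals all_analysis.
From mathcomp Require Import complex.

Set Implicit Arguments.
Unset Strict Implicit.
Unset Printing Implicit Defensive.

Import Order.TTheory GRing.Theory Num.Theory.
Local Open Scope ring_scope.
Local Open Scope complex_scope.

Section Torus.
Variable R : realType.

Definition cis2pi (x : R) : R[i] := cos (2 * pi * x) +i* sin (2 * pi * x).

Definition torus_pt d (t : 'rV[R]_d) : 'rV[R[i]]_d := map_mx cis2pi t.

Definition monomial d (z : 'rV[R[i]]_d) (k : 'rV[int]_d) : R[i] :=
  \prod_(i < d) z 0 i ^ k 0 i.

Definition in_cube d (t : 'rV[R]_d) : Prop := forall i, 0 <= t 0 i < 1.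

End Torus.

(* I_n = {0, ..., n}^d.  Vectors and matrices indexed by I_n are stored as
   ordinary vectors and matrices of dimension #|{: Idx d n}|, the
   multi-index of coordinate i being [enum_val i]. *)
Notation Idx d n := 'rV['I_n.+1]_d.

Definition idx_int d n (k : Idx d n) : 'rV[int]_d :=
  \row_i (nat_of_ord (k 0 i))%:Z.

Definition coord_idx d n (i : 'I_#|{: Idx d n}|) : 'rV[int]_d :=
  idx_int (enum_val i).

Lemma card_Idx d n : #|{: Idx d n}| = (n.+1 ^ d)%N.
Proof. by rewrite card_mx card_ord mul1n. Qed.

Section Toeplitz.
Variable R : realType.

Definition toeplitz d n (f : 'rV[int]_d -> R[i]) : 'M[R[i]]_#|{: Idx d n}| :=
  \matrix_(l, k) f (coord_idx k - coord_idx l).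

(* Vectors of C^N are row vectors u, for which T_n(f) u is [u *m T^T]. *)
Definition toeplitz_ker d n (f : 'rV[int]_d -> R[i]) :
    {vspace 'rV[R[i]]_#|{: Idx d n}|} :=
  lker (linfun (mulmxr (toeplitz n f)^T)).

Definition expsum d M (fhat : 'I_M -> R[i]) (z : 'I_M -> 'rV[R[i]]_d)
    (k : 'rV[int]_d) : R[i] :=
  \sum_(j < M) fhat j * monomial (z j) k.

Definition is_onb N (s : seq 'rV[R[i]]_N) : Prop :=
  basis_of fullv s /\ orthonormal (@dotmx R[i] N) s.

Definition vec_poly d n (u : 'rV[R[i]]_#|{: Idx d n}|) (z : 'rV[R[i]]_d) : R[i] :=
  \sum_i u 0 i * monomial z (coord_idx i).

Definition max_norm d (k : 'rV[int]_d) : nat := (\max_(i < d) absz (k ord0 i))%N.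

Definition trig_sum d (s : seq ('rV[int]_d * R[i])) (t : 'rV[R]_d) : R[i] :=
  \sum_(kc <- s) kc.2 * cis2pi (\sum_(i < d) (kc.1 0 i)%:~R * t 0 i).

(* "Of degree n" is the usual "of degree at most n": the coefficients at
   frequencies of max-norm n may all vanish. *)
Definition trig_poly_on_cube d (n : nat) (f : 'rV[R]_d -> R[i]) : Prop :=
  exists s : seq ('rV[int]_d * R[i]),
    (forall kc, kc \in s -> (max_norm kc.1 <= n)%N) /\
    (forall t, in_cube t -> f t = trig_sum s t).

End Toeplitz.

(* Main.v *)
(* Write p_u(z) = <u, w(z)>, where w(z) has the conjugated monomials of z as
   entries, and w_j = w(z_j).  If u is orthogonal to every w_j then T_n u = 0,
   so the first M basis vectors lie in the span of w_1, ..., w_M and, being M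
   independent vectors, they span it.  By Parseval,
     1 - p(t) = N^-1 * sum_(l > M) |<p_l, w(e^(2 pi i t))>|^2,
   which is nonnegative and vanishes at every t_j.  If t is none of the t_j, a
   product of M <= n linear factors, one vanishing at each z_j, gives u
   orthogonal to all w_j but not to w(e^(2 pi i t)); since u lies in the span of
   the remaining p_l, one of these does not vanish at e^(2 pi i t). *)
Require Import Defs.
From mathcomp Require Import all_boot all_order all_algebra.
From mathcomp Require Import sesquilinear spectral.
From mathcomp Require Import all_classical all_reals all_analysis.
From mathcomp Require Import complex zify ring lra.
Import Order.TTheory GRing.Theory Num.Theory.
Local Open Scope ring_scope.
Local Open Scope complex_scope.

(** * Orthonormal bases as rows of a unitary matrix *)

Section UnitaryRows.
Local Open Scope sesquilinear_scope.
Context {C : numClosedFieldType}.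

Lemma dotmx_conjC {N} (u v : 'rV[C]_N) : dotmx u v = Num.conj (dotmx v u).
Proof.
rewrite !dotmxE !mxE rmorph_sum; apply: eq_bigr => i _.
by rewrite !mxE rmorphM /= conjCK mulrC.
Qed.

(** Squareness is the equation [m = N] because basis vectors are counted by [n.+1 ^ d] and
    coordinates by [#|{: Idx d n}|], related through [card_Idx]. *)
Lemma unitarymx_sum_row {m N} (U : 'M[C]_(m, N)) (u : 'rV[C]_N) :
  m = N -> U \is unitarymx -> u = \sum_l dotmx u (row l U) *: row l U.
Proof.
move=> mN Uu; rewrite -[LHS](mulmxKtV u Uu mN) mulmx_sum_row.
apply: eq_bigr => l _; congr (_ *: _).
by rewrite dotmxE !mxE; apply: eq_bigr => i _; rewrite !mxE.
Qed.

Lemma unitarymx_parseval {m N} (U : 'M[C]_(m, N)) (w : 'rV[C]_N) :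
  m = N -> U \is unitarymx ->
  \sum_l `|dotmx (row l U) w| ^+ 2 = dotmx w w.
Proof.
move=> mN Uu; rewrite {2}(unitarymx_sum_row _ w mN Uu) linear_sumlz.
apply: eq_bigr => l _ /=.
by rewrite linearZl_LR /= normCK mulrC -dotmx_conjC.
Qed.

(* Each of the first [k] rows of [U] lies in the row space of [A]; as they are
   [k] independent vectors and [A] has [k] rows, they span it. *)
Lemma unitarymx_dot_row_eq0 {m N k} (U : 'M[C]_(m, N)) (A : 'M[C]_(k, N)) :
  U \is unitarymx -> (k <= m)%N ->
  (forall u, (forall j, dotmx u (row j A) = 0) ->
     forall l : 'I_m, (l < k)%N -> dotmx (row l U) u = 0) ->
  forall (l : 'I_m) j, (k <= l)%N -> dotmx (row l U) (row j A) = 0.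
Proof.
move=> Uu km UA l j kl.
pose P := rowsub (widen_ord km) U.
have dU := row_unitarymxP Uu.
have rPE i : row i P = row (widen_ord km i) U.
  by apply/rowP => x; rewrite !mxE.
have Pu : P \is unitarymx.
  by apply/row_unitarymxP => i i'; rewrite !rPE dU -val_eqE.
(* Passing to orthogonal complements turns this inclusion into [UA]. *)
have PA : (P <= A)%MS.
  rewrite -submx_ortho; apply/row_subP => i; apply/orthomx1P.
  set u := row i _.
  have uA : u *m A^t* = 0 by apply/orthomx1P; apply: row_sub.
  have {}uA j' : dotmx u (row j' A) = 0.
    move/matrixP/(_ 0 j'): uA; rewrite dotmxE !mxE => uA; rewrite -[RHS]uA.
    by apply: eq_bigr => x _; rewrite !mxE.
  apply/rowP => i'; have := UA u uA (widen_ord km i') (ltn_ord i').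
  rewrite dotmx_conjC -rPE => /eqP; rewrite conjC_eq0 => /eqP.
  rewrite dotmxE !mxE => uP; rewrite -[RHS]uP.
  by apply: eq_bigr => x _; rewrite !mxE.
have AP : (row j A <= P)%MS.
  apply: submx_trans (row_sub _ _) _.
  rewrite -(geq_leqif (mxrank_leqif_sup PA)) (mxrank_unitary Pu).
  exact: rank_leq_row.
case/submxP: AP => D ->; rewrite dotmx_conjC mulmx_sum_row linear_sumlz /=.
rewrite big1 ?rmorph0 // => i _; rewrite linearZl_LR /= rPE dU -val_eqE /=.
by rewrite ltn_eqF ?mulr0 // (leq_trans (ltn_ord i)).
Qed.

End UnitaryRows.

(** * The exponential and its injectivity on [0, 1) *)

Section Cis.
Context {R : realType}.
Implicit Types x y : R.

Lemma cis2piD x y : cis2pi (x + y) = cis2pi x * cis2pi y.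
Proof.
rewrite /cis2pi mulrDr cosD sinD; apply/eqP; rewrite eq_complex /= eqxx /=.
by apply/eqP; ring.
Qed.

Lemma cis2pi0 : cis2pi 0 = 1 :> R[i].
Proof. by rewrite /cis2pi mulr0 cos0 sin0. Qed.

Lemma cis2piN x : cis2pi (- x) = Num.conj (cis2pi x).
Proof. by rewrite /cis2pi mulrN cosN sinN. Qed.

Lemma cis2pi_mul_conj x : cis2pi x * Num.conj (cis2pi x) = 1.
Proof. by rewrite -cis2piN -cis2piD subrr cis2pi0. Qed.

Lemma cis2pi_neq0 x : cis2pi x != 0.
Proof.
apply/eqP => x0; have := cis2pi_mul_conj x; rewrite x0 mul0r => /eqP.
by rewrite eq_sym oner_eq0.
Qed.

Lemma cis2piNV x : cis2pi (- x) = (cis2pi x)^-1.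
Proof.
by apply: (mulfI (cis2pi_neq0 x)); rewrite -cis2piD subrr cis2pi0 mulfV ?cis2pi_neq0.
Qed.

Lemma cis2pi_sum I (r : seq I) (F : I -> R) :
  cis2pi (\sum_(i <- r) F i) = \prod_(i <- r) cis2pi (F i).
Proof. exact: (big_morph _ cis2piD cis2pi0). Qed.

Lemma cis2piMz (k : int) x : cis2pi (k%:~R * x) = cis2pi x ^ k.
Proof.
have cisMn m : cis2pi (m%:R * x) = cis2pi x ^+ m.
  elim: m => [|m IH]; first by rewrite mul0r cis2pi0.
  by rewrite -natr1 mulrDl mul1r cis2piD IH exprSr.
case: k => m; first exact: cisMn.
by rewrite NegzE mulrNz mulNr cis2piNV cisMn -exprnN.
Qed.

(** The real part gives 1 - 2 sin(pi x)^2 = 1, while sin is positive on (0, pi). *)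
Lemma cis2pi_eq1 x : 0 <= x < 1 -> cis2pi x = 1 -> x = 0.
Proof.
move=> /andP[x0 x1] [c1 _]; apply/eqP; rewrite eq_le x0 andbT leNgt.
apply/negP => x_gt0.
have s_gt0 : 0 < sin (pi * x).
  apply: sin_gt0_pi; rewrite mulr_gt0 ?pi_gt0 //=.
  by rewrite gtr_pMr ?pi_gt0.
move: c1; rewrite -mulrA mulr_natl cos_mulr2n cos2sin2 => c1.
have : sin (pi * x) ^+ 2 = 0 by lra.
by move/eqP; rewrite sqrf_eq0 gt_eqF.
Qed.

Lemma cis2pi_inj x y : 0 <= x < 1 -> 0 <= y < 1 -> cis2pi x = cis2pi y -> x = y.
Proof.
wlog yx : x y / y <= x.
  move=> H hx hy e; case: (leP y x) => [yx|/ltW xy]; first exact: H.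
  by apply/esym/H.
move=> /andP[x0 x1] /andP[y0 y1] e; apply/eqP; rewrite -subr_eq0.
apply/eqP/cis2pi_eq1; first lra.
by rewrite cis2piD e cis2piN cis2pi_mul_conj.
Qed.

End Cis.

(** * Polynomials with exponents in I_n *)

Section Polynomials.
Context {R : realType} {d n : nat}.
Local Notation N := #|{: Idx d n}|.
Implicit Types (t : 'rV[R]_d) (k l : 'rV[int]_d) (u : 'rV[R[i]]_N).

Lemma monomial_torus t k :
  monomial (torus_pt t) k = cis2pi (\sum_(i < d) (k 0 i)%:~R * t 0 i).
Proof.
by rewrite cis2pi_sum; apply: eq_bigr => i _; rewrite mxE cis2piMz.
Qed.

(** On the torus inversion is conjugation. This factors the Toeplitz entries and the exponentials in
    an expanded squared modulus. *)
Lemma monomial_torusB t k l :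
  monomial (torus_pt t) (k - l)
  = monomial (torus_pt t) k * Num.conj (monomial (torus_pt t) l).
Proof.
rewrite !monomial_torus -cis2piN -cis2piD -sumrB; congr cis2pi.
by apply: eq_bigr => i _; rewrite !mxE rmorphB mulrBl.
Qed.

Lemma max_norm_coord_idxB (i j : 'I_N) :
  (max_norm (coord_idx i - coord_idx j) <= n)%N.
Proof.
apply/bigmax_leqP => x _; rewrite !mxE.
case: (enum_val i _ x) => a /= an; case: (enum_val j _ x) => b /= bn.
lia.
Qed.

(* The conjugation makes [vec_poly u z] the inner product of [u] with this
   vector. *)
Definition monomial_vec (z : 'rV[R[i]]_d) : 'rV[R[i]]_N :=
  \row_i Num.conj (monomial z (coord_idx i)).

Lemma vec_polyE u z : vec_poly u z = dotmx u (monomial_vec z).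
Proof.
by rewrite dotmxE mxE; apply: eq_bigr => i _; rewrite !mxE conjCK.
Qed.

Lemma dotmx_monomial_vec_torus t :
  dotmx (monomial_vec (torus_pt t)) (monomial_vec (torus_pt t)) = N%:R.
Proof.
rewrite dotmxE mxE -[in RHS](card_ord N) -sumr_const; apply: eq_bigr => i _.
by rewrite !mxE conjCK mulrC !monomial_torus cis2pi_mul_conj.
Qed.

Lemma trig_poly_sum_normsq (I : finType) (P : pred I) c
    (u_ : I -> 'rV[R[i]]_N) :
  trig_poly_on_cube n (fun t : 'rV[R]_d =>
    c * \sum_(l | P l) `|vec_poly (u_ l) (torus_pt t)| ^+ 2).
Proof.
(* One term per pair of indices; pairs with the same difference stay separate, as [trig_sum] allows
   repeated frequencies. *)
exists [seq (coord_idx ij.1 - coord_idx ij.2,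
             c * \sum_(l | P l) u_ l 0 ij.1 * Num.conj (u_ l 0 ij.2))
        | ij <- index_enum ('I_N * 'I_N)%type]; split.
  by move=> _ /mapP[ij _ ->]; apply: max_norm_coord_idxB.
move=> t _; rewrite /trig_sum big_map /=.
under [RHS]eq_bigr => ij _ do
  rewrite -monomial_torus monomial_torusB -mulrA mulr_suml.
rewrite -mulr_sumr exchange_big /=; congr (_ * _); apply: eq_bigr => l _.
rewrite normCK /vec_poly rmorph_sum mulr_suml.
under [LHS]eq_bigr => i _ do rewrite mulr_sumr.
rewrite pair_big; apply: eq_bigr => -[i j] _ /=.
by rewrite rmorphM mulrACA.
Qed.

Lemma vec_poly_prod (q : 'I_d -> {poly R[i]}) :
  (forall i, (size (q i) <= n.+1)%N) ->
  exists u, forall z, vec_poly u z = \prod_(i < d) (q i).[z 0 i].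
Proof.
move=> qn.
exists (\row_(k < N) \prod_(i < d) (q i)`_((enum_val k : Idx d n) 0 i)) => z.
under [RHS]eq_bigr => i _ do rewrite (horner_coef_wide _ (qn i)).
rewrite bigA_distr_bigA /= /vec_poly.
(* Distributivity yields a sum over functions from ['I_d] to ['I_n.+1], which are the multi-indices
   in another encoding. *)
rewrite (reindex (fun k : 'I_N => [ffun i => (enum_val k : Idx d n) 0 i])) /=.
  apply: eq_bigr => k _; rewrite mxE -big_split /=; apply: eq_bigr => i _.
  by rewrite ffunE /coord_idx mxE.
exists (fun f : {ffun _} => enum_rank (\row_i f i : Idx d n)) => [k _|f _].
  apply: enum_val_inj; rewrite enum_rankK.
  by apply/rowP => i; rewrite !mxE ffunE.
by apply/ffunP => i; rewrite ffunE enum_rankK mxE.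
Qed.

Lemma vec_poly_separates {M} (z : 'I_M -> 'rV[R[i]]_d) (w : 'rV[R[i]]_d) :
  (M <= n)%N -> (forall j, z j != w) ->
  exists2 u : 'rV[R[i]]_N, forall j, vec_poly u (z j) = 0 & vec_poly u w != 0.
Proof.
move=> Mn zw.
have /fin_all_exists[c cP] j : exists i, z j 0 i != w 0 i.
  apply/existsP; apply: contraNT (zw j); rewrite negb_exists => /forallP e.
  by apply/eqP/rowP => i; apply/eqP; rewrite -[_ == _]negbK e.
(* [u] holds the coefficients of [\prod_j ('X_(c j) - z j 0 (c j))]. *)
have [i|u uE] := vec_poly_prod (fun i => \prod_(j | c j == i) ('X - (z j 0 i)%:P)).
  (* The degree in variable [i] is the number of [j] with [c j = i], hence at most M <= n. *)
  rewrite -big_filter size_prod_XsubC ltnS size_filter.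
  by rewrite (leq_trans (count_size _ _)) // /index_enum -enumT size_enum_ord.
exists u => [j|].
  rewrite uE (bigD1 (c j)) //= horner_prod (bigD1 j) //= hornerXsubC.
  by rewrite subrr !mul0r.
rewrite uE prodf_seq_neq0; apply/allP => i _ /=.
rewrite horner_prod prodf_seq_neq0; apply/allP => j _.
by apply/implyP => /eqP <-; rewrite hornerXsubC subr_eq0 eq_sym cP.
Qed.

(** Entry l of T_n u is the sum over j of fhat_j conj(z_j^l) p_u(z_j). *)
Lemma mem_toeplitz_ker {M} (fhat : 'I_M -> R[i]) (t_ : 'I_M -> 'rV[R]_d) u :
  (forall j, vec_poly u (torus_pt (t_ j)) = 0) ->
  u \in toeplitz_ker n (expsum fhat (fun j => torus_pt (t_ j))).
Proof.
move=> u0; rewrite memv_ker lfunE /=; apply/eqP/rowP => l; rewrite !mxE.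
under eq_bigr => k _ do rewrite !mxE mulr_sumr.
rewrite exchange_big big1 //= => j _.
under eq_bigr => k _ do rewrite monomial_torusB mulrCA [X in _ * X]mulrA mulrA.
by rewrite -mulr_suml -mulr_sumr -/(vec_poly u _) u0 mulr0 mul0r.
Qed.

Lemma torus_pt_inj t t' :
  in_cube t -> in_cube t' -> torus_pt t = torus_pt t' -> t = t'.
Proof.
move=> ct ct' e; apply/rowP => i; apply: cis2pi_inj => //.
by move/rowP/(_ i): e; rewrite !mxE.
Qed.

End Polynomials.

Theorem theorem3p5 (R : realType) (d n M : nat) (hnM : (M <= n)%N)
  (t_ : 'I_M -> 'rV[R]_d) (ht : forall j, in_cube (t_ j)) (t_inj : injective t_)
  (fhat : 'I_M -> R[i]) (hf : forall j, fhat j != 0)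
  (phat : (n.+1 ^ d).-tuple 'rV[R[i]]_#|{: Idx d n}|)
  (phat_onb : is_onb phat)
  (phat_ker : forall l : 'I_(n.+1 ^ d), (l < M)%N ->
     tnth phat l \in orthov (@dotmx R[i] #|{: Idx d n}|)
       (toeplitz_ker n (expsum fhat (fun j => torus_pt (t_ j))))) :
  let p (t : 'rV[R]_d) : R[i] :=
    ((n.+1 ^ d)%N%:R)^-1 *
      \sum_(l < n.+1 ^ d | (l < M)%N)
         `|vec_poly (tnth phat l) (torus_pt t)| ^+ 2 in
  [/\ trig_poly_on_cube n p,
      forall t, in_cube t -> 0 <= p t <= 1
    & forall t, in_cube t -> (p t = 1 <-> exists j, t = t_ j)].
Proof.
move=> p; have Npos : (0 : R[i]) < ((n.+1 ^ d)%N)%:R by rewrite ltr0n expn_gt0.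
have NE := esym (card_Idx d n).
pose U := \matrix_l tnth phat l.
have UE l : row l U = tnth phat l by rewrite rowK.
have Uu : U \is unitarymx.
  case: phat_onb => _ /orthonormalP[uniq_phat ophat].
  apply/row_unitarymxP => l l'; rewrite !UE ophat ?mem_tnth //.
  by rewrite (inj_eq (tuple_uniqP _ uniq_phat)).
have ker_orth (u : 'rV[R[i]]_#|{: Idx d n}|) :
    (forall j, vec_poly u (torus_pt (t_ j)) = 0) ->
    forall l : 'I_(n.+1 ^ d), (l < M)%N -> dotmx (tnth phat l) u = 0.
  move=> u0 l lM; move/mem_orthovP: (phat_ker l lM); apply.
  exact: mem_toeplitz_ker.
(* For d = 0 the cube is a single point, so injectivity forces M <= 1; otherwise M <= n < n + 1 <=
   (n + 1)^d. *)
have MN : (M <= n.+1 ^ d)%N.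
  case: (posnP d) => [d0|d_gt0].
    rewrite d0 expn0 leqNgt; apply/negP => M_gt1.
    suff /t_inj : t_ (Ordinal (ltnW M_gt1)) = t_ (Ordinal M_gt1) by [].
    by apply/rowP => -[x xd]; exfalso; rewrite d0 in xd.
  apply: leq_trans hnM (leq_trans (leqnSn n) _).
  by rewrite -{1}[n.+1]expn1 leq_pexp2l.
pose q t (l : 'I_(n.+1 ^ d)) := `|vec_poly (tnth phat l) (torus_pt t)| ^+ 2.
have invN_ge0 : (0 : R[i]) <= (n.+1 ^ d)%N%:R^-1 by rewrite invr_ge0 ltW.
have q0 t l : 0 <= q t l by rewrite exprn_ge0.
have parseval t : \sum_l q t l = ((n.+1 ^ d)%N)%:R.
  rewrite [in RHS]NE -(dotmx_monomial_vec_torus t).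
  rewrite -(unitarymx_parseval U _ NE Uu).
  by apply: eq_bigr => l _; rewrite /q vec_polyE UE.
have pE t : p t = 1 - (n.+1 ^ d)%N%:R^-1 * \sum_(l < n.+1 ^ d | ~~ (l < M)%N) q t l.
  apply/eqP; rewrite eq_sym subr_eq /p -mulrDr; move: (parseval t).
  rewrite (bigID (fun l : 'I_(n.+1 ^ d) => (l < M)%N)) /= => ->.
  by rewrite mulVf // gt_eqF.
have p_eq1 t : p t = 1 <->
    forall l : 'I_(n.+1 ^ d), ~~ (l < M)%N -> vec_poly (tnth phat l) (torus_pt t) = 0.
  rewrite pE; split => [/eqP|q_eq0]; last first.
    by rewrite big1 ?mulr0 ?subr0 // => l lM; rewrite /q q_eq0 // normr0 expr0n.
  rewrite -subr_eq0 addrAC subrr sub0r oppr_eq0 mulf_eq0 invr_eq0 gt_eqF //=.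
  rewrite psumr_eq0 // => /allP /= q_eq0 l lM; apply/eqP.
  by move: (q_eq0 l); rewrite mem_index_enum lM /q sqrf_eq0 normr_eq0; apply.
split=> [|t _|t tc]; first exact: trig_poly_sum_normsq.
  apply/andP; split; first by rewrite mulr_ge0 ?sumr_ge0.
  by rewrite pE lerBlDr lerDl mulr_ge0 // sumr_ge0.
rewrite p_eq1; split => [pt|[j ->] l].
  apply: contrapT => tj.
  have [|u u0 /eqP] :=
    vec_poly_separates (fun j => torus_pt (t_ j)) (torus_pt t) hnM.
    by move=> j; apply/eqP => /torus_pt_inj e; apply: tj; exists j; apply/esym/e.
  (* In the basis expansion of [u], the first M coefficients vanish by [ker_orth], and the other
     basis polynomials vanish at [t] by [pt]. *)
  apply; rewrite vec_polyE (unitarymx_sum_row U u NE Uu) linear_sumlz big1 //=.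
  move=> l _; rewrite linearZl_LR /= UE -vec_polyE; case: (boolP (l < M)%N) => lM.
    by rewrite dotmx_conjC ker_orth // rmorph0 mul0r.
  by rewrite pt // mulr0.
rewrite -leqNgt => Ml; rewrite vec_polyE -UE.
(* With the vectors w_j as rows of [A], the span hypothesis of [unitarymx_dot_row_eq0] is
   [ker_orth]. *)
pose A := \matrix_(j' < M) (monomial_vec (torus_pt (t_ j')) : 'rV[R[i]]_#|{: Idx d n}|).
rewrite -[monomial_vec _](rowK (fun j' => monomial_vec (torus_pt (t_ j')))).
apply: (unitarymx_dot_row_eq0 U A Uu MN) => // u uA l' l'M.
by rewrite UE ker_orth // => j'; rewrite vec_polyE -(uA j') rowK.
Qed.
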